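(* Let $G$ be a finite simple graph. The gyrochromatic number $\chi_g(G)$ is equal to the infimum of $N/K$ over all pairs of positive integers $N,K$ for which there exist a $K$-element set $A\subseteq\mathbb{Z}_N$ and a function $f:V(G)\to\mathbb{Z}_N$ such that $A+f(u)$ and $A+f(v)$ are disjoint for every edge $uv$ of $G$.
   Context: $\mathbb{Z}_N=\mathbb{Z}/N\mathbb{Z}$. Let $\mathbb{T}=\mathbb{R}/\mathbb{Z}$ with Haar (Lebesgue) probability measure $\mu$. A set $A\subseteq \mathbb{T}$ is a coloring $\mathbb{T}$-base for $G$ if there exists a function $f:V(G)\to \mathbb{T}$ such that $A+f(u)$ and $A+f(v)$ are disjoint for every edge $uv$ of $G$. Let $\sigma_{\mathbb{T}}(G)=\sup\{\mu(A): A \text{ is a Borel coloring } \mathbb{T}\text{-base for } G\}$. The gyrochromatic number of $G$ is $\chi_g(G)=1/\sigma_{\mathbb{T}}(G)$. *)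

(* Defs.v *)
From HB Require Import structures.
From mathcomp Require Import all_boot all_order all_algebra.
From mathcomp Require Import all_classical all_reals all_analysis.
Import Order.TTheory GRing.Theory Num.Theory.
Import numFieldNormedType.Exports.

Set Implicit Arguments.
Unset Strict Implicit.
Unset Printing Implicit Defensive.

Local Open Scope classical_set_scope.
Local Open Scope ring_scope.
Local Open Scope quotient_scope.
Definition circle (R : realType) : Type :=
  {ideal_quot (GRing.ZmodClosed.clone R Num.int_num_subdef _)}.

HB.instance Definition _ (R : realType) := GRing.Zmodule.on (circle R).
HB.instance Definition _ (R : realType) := Quotient.on (circle R).

Definition circle_borel (R : realType) : set_system (circle R) :=
  <<s [set U | open (U : set (quotient_topology (circle R)))] >>.

(* Haar measure is the image of Lebesgue measure on the fundamental domain
   [0, 1[ under the projection R -> R/Z. *)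
Definition haar (R : realType) (A : set (circle R)) : \bar R :=
  lebesgue_measure (\pi_(circle R) @^-1` A `&` `[0, 1[).

Definition translate (Z : zmodType) (A : set Z) (x : Z) : set Z :=
  [set a + x | a in A].

(* The edges of the graph are the pairs u, v with e u v. *)
Definition coloring_base (V : finType) (e : rel V) (Z : zmodType)
    (A : set Z) : Prop :=
  exists f : V -> Z, forall u v : V, e u v ->
    translate A (f u) `&` translate A (f v) = set0.

(* The set below contains the measure of the empty set and is bounded above
   by 1, so that sup is its least upper bound. *)
Definition sigma_circle (R : realType) (V : finType) (e : rel V) : R :=
  sup [set fine (haar A) | A in
        [set A : set (circle R) | circle_borel A /\ coloring_base e A]].

Definition gyrochromatic (R : realType) (V : finType) (e : rel V) : R :=
  1 / sigma_circle R e.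

(* Meant for 0 < N; unlike 'Z_N, this is the trivial group when N = 1. *)
Definition Zmod (N : nat) : Type := 'I_N.-1.+1.

HB.instance Definition _ (N : nat) := Finite.on (Zmod N).
HB.instance Definition _ (N : nat) := GRing.Zmodule.on (Zmod N).

(* Main.v *)
(* A K-element base in Z_N blows up to K arcs of length 1/N, which form a base of
   measure K/N for the circle.  Conversely, let A be a Borel base for the circle
   with shifts f, and let n be the number of vertices.  By translation invariance
   some x has at least mu(A) L^n of the points x + sum_v i_v f(v), i in
   {0, ..., L-1}^n, in A; the set B of these i satisfies (B + delta_u) disjoint
   from (B + delta_v) for every edge uv.  Reading i in base L+1 embeds
   {0, ..., L}^n into Z_N with N = (L+1)^n and turns B into a base with
   K/N >= mu(A) (L/(L+1))^n, and L tends to infinity. *)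
Require Import Defs.
From mathcomp Require Import all_boot all_order all_algebra.
From mathcomp Require Import all_classical all_reals all_analysis.
From mathcomp Require Import measurable_realfun.
From mathcomp Require Import zify ring lra.
Import Order.TTheory GRing.Theory Num.Theory.
Import numFieldNormedType.Exports.
Local Open Scope classical_set_scope.
Local Open Scope ring_scope.

(** * Translation invariance on the line and averaging over a period *)

Lemma measurable_fun_shift (R : realType) (t : R) :
  measurable_fun [set: measurableTypeR R]
    (fun x : measurableTypeR R => x + t : measurableTypeR R).
Proof.
apply: (@open_continuous_measurable_fun R setT) => [|x _]; first exact: openT.
by apply: cvgD; [exact: cvg_id|exact: cvg_cst].
Qed.

Lemma measurable_shift (R : realType) (B : set (measurableTypeR R)) (t : R) :
  measurable B -> measurable ((fun x => x + t) @^-1` B).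
Proof. by move=> mB; rewrite -[X in measurable X]setTI; exact: measurable_fun_shift. Qed.

(** The pushforward of Lebesgue measure under the shift gives each half-open interval its length, so
    it is Lebesgue measure by uniqueness. *)
Lemma lebesgue_measure_shift (R : realType) (B : set (measurableTypeR R)) (t : R) :
  measurable B ->
  lebesgue_measure ((fun x => x + t) @^-1` B) = lebesgue_measure B.
Proof.
move=> mB; have msh := measurable_fun_shift R t.
pose nu : {measure set (measurableTypeR R) -> \bar R} :=
  pushforward lebesgue_measure (fun x : measurableTypeR R => x + t : measurableTypeR R).
symmetry; apply: (@lebesgue_measure_unique R (nu msh)) => // _ [[a b] _ <-] /=.
have -> : nu msh `]a, b]%classic = lebesgue_measure (`]a - t, b - t]%classic : set R).
  rewrite /nu /pushforward; congr (lebesgue_measure _).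
  by apply/seteqP; split => x /=; rewrite !in_itv /= ltrBlDr lerBrDr.
rewrite !lebesgue_measure_itv /= !lte_fin ltrD2r.
by case: ifP => // _; congr EFin; ring.
Qed.

Definition periodic {R : realType} (B : set R) :=
  forall (x : R) (n : int), B (x + n%:~R) <-> B x.

Lemma lebesgue_measure_itvco01 (R : realType) :
  lebesgue_measure (`[0, 1[%classic : set R) = 1%E.
Proof. by rewrite lebesgue_measure_itv /= lte_fin ltr01 oppr0 adde0. Qed.

(** By periodicity [t] may be replaced by its fractional part [s]. The shift then moves the window
    to [[s, 1 + s[], whose piece beyond 1 is carried back by an integer translation onto [[0,
    s[]. *)
Lemma lebesgue_measure_periodic_shift (R : realType) (B : set (measurableTypeR R))
    (t : R) : measurable B -> periodic B ->
  lebesgue_measure ((fun x => x + t) @^-1` B `&` `[0, 1[) =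
  lebesgue_measure (B `&` `[0, 1[).
Proof.
move=> mB pB.
have [s s01 ->] : exists2 s : R, 0 <= s < 1 &
    (fun x => x + t) @^-1` B = (fun x => x + s) @^-1` B.
  exists (t - (Num.floor t)%:~R).
    by have /andP[] := floor_itv t; rewrite intrD; lra.
  apply/seteqP; split=> x /=.
    by rewrite -[in X in B X -> _](subrK (Num.floor t)%:~R t) addrA => /pB.
  by move=> /(pB _ (Num.floor t)).2; rewrite -addrA subrK.
have mI (i : interval R) : measurable ([set` i] : set (measurableTypeR R)) by exact: measurable_itv.
have {s01} [s0 s1] := andP s01.
transitivity (lebesgue_measure (B `&` `[s, 1 + s[)).
  rewrite -[RHS](lebesgue_measure_shift _ _ s); last exact: measurableI.
  congr (lebesgue_measure _); rewrite preimage_setI; congr (_ `&` _).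
  by apply/seteqP; split=> x /=; rewrite !in_itv /=; lra.
have split_itv (a b c : R) : a <= b -> b <= c ->
    lebesgue_measure (B `&` `[a, c[) =
    (lebesgue_measure (B `&` `[a, b[) + lebesgue_measure (B `&` `[b, c[))%E.
  move=> ab bc; rewrite -measureU; [|exact: measurableI..|].
    rewrite -setIUr; congr (lebesgue_measure (_ `&` _)).
    apply/seteqP; split=> x /=; rewrite !in_itv /=; last first.
      by case=> /andP[? ?]; apply/andP; split; lra.
    by move=> /andP[? ?]; have [?|?] := ltP x b; [left|right]; apply/andP; split.
  apply/seteqP; split=> // x [[_ +] [_ +]] /=.
  by rewrite /mkset !in_itv /= => /andP[_ xb] /andP[/(lt_le_trans xb)]; rewrite ltxx.
have s2 : 1 <= 1 + s by rewrite lerDl.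
rewrite (split_itv s 1 (1 + s) (ltW s1) s2) (split_itv 0 s 1 s0 (ltW s1)) addeC.
congr (_ + _)%E; rewrite -[LHS](lebesgue_measure_shift _ _ 1); last exact: measurableI.
congr (lebesgue_measure _); rewrite preimage_setI; congr (_ `&` _).
  by apply/seteqP; split=> x /= /(pB x 1).
by apply/seteqP; split=> x /=; rewrite !in_itv /=; lra.
Qed.

(** The left side is the integral over [[0, 1[] of the number of [i] with [x + s i] in [B], because
    each shifted indicator has the same integral; a maximal value of this count is at least its
    mean. *)
Lemma periodic_average (R : realType) (B : set (measurableTypeR R)) (I : finType)
    (s : I -> R) : measurable B -> periodic B ->
  exists x : R, #|I|%:R * fine (lebesgue_measure (B `&` `[0, 1[)) <=
    #|[set i | `[< B (x + s i) >]]%SET|%:R :> R.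
Proof.
move=> mB pB; pose c (x : R) := #|[set i | `[< B (x + s i) >]]%SET|.
pose P k := `[< exists x, c x = k >].
have exP : exists k, P k by exists (c 0); apply/asboolP; exists 0.
have leP k : P k -> (k <= #|I|)%N by move=> /asboolP[x <-]; exact: max_card.
(* The count is a natural number bounded by [#|I|], so its maximum over all real [x] is attained. *)
case: (ex_maxnP exP leP) => k /asboolP[x0 cx0] maxk; exists x0.
rewrite -/(c x0) cx0.
have mI : measurable (`[0, 1[%classic : set (measurableTypeR R)).
  exact: measurable_itv.
pose Bs i : set (measurableTypeR R) := (fun x => x + s i) @^-1` B.
have mBs i : measurable (Bs i) by exact: measurable_shift.
have l01 := lebesgue_measure_itvco01 R.
have fin : lebesgue_measure (B `&` `[0, 1[) \is a fin_num.
  rewrite ge0_fin_numE //; apply: (@le_lt_trans _ _ 1%E); last exact: ltry.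
  rewrite -l01; apply: le_measure; last exact: subIsetr.
    by rewrite inE; exact: measurableI.
  by rewrite inE.
rewrite -lee_fin EFinM fineK //.
have sumE : (\sum_(i : I) \int[lebesgue_measure]_(x in `[0%R, 1%R[) (\1_(Bs i) x)%:E =
    #|I|%:R%:E * lebesgue_measure (B `&` `[0%R, 1%R[))%E.
  rewrite (eq_bigr (fun=> lebesgue_measure (B `&` `[0%R, 1%R[))).
    rewrite big_const -(fineK fin) -EFinM mulr_natl.
    by elim: #|I| => //= n ->; rewrite -EFinD mulrS.
  by move=> i _; rewrite integral_indic //; exact: lebesgue_measure_periodic_shift.
have mf i : measurable_fun (`[0, 1[%classic : set (measurableTypeR R))
    (fun x : measurableTypeR R => (\1_(Bs i) x)%:E).
  by apply/measurable_EFinP; exact: measurable_indic.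
rewrite -sumE -ge0_integral_sum //.
apply: (@le_trans _ _ (\int[lebesgue_measure]_(x in `[0%R, 1%R[) (k%:R%:E : \bar R))%E).
  apply: ge0_le_integral => //.
  - by move=> x _; apply: sume_ge0 => i _; rewrite lee_fin.
  - exact: emeasurable_sum.
  move=> x _; rewrite sumEFin lee_fin.
  have -> : \sum_i \1_(Bs i) x = (c x)%:R :> R.
    rewrite /c -sum1_card natr_sum [RHS]big_mkcond; apply: eq_bigr => i _.
    by rewrite inE indicE /Bs; case: asboolP => [?|?]; [rewrite mem_set|rewrite memNset].
  by rewrite ler_nat; apply: maxk; apply/asboolP; exists x.
by rewrite integral_cst //= l01 mule1.
Qed.

(** * Positional notation and the embedding of a grid into a cyclic group *)

Lemma radix_lt (M n : nat) (a : nat -> nat) :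
  (forall i, (i < n)%N -> (a i < M)%N) -> (\sum_(i < n) a i * M ^ i < M ^ n)%N.
Proof.
elim: n => [|n IHn] aM; first by rewrite big_ord0.
rewrite big_ord_recr /= expnS.
apply: (@leq_trans (M ^ n + a n * M ^ n)).
  by rewrite ltn_add2r; apply: IHn => i /ltnW; exact: aM.
by rewrite -mulSn leq_mul2r aM // orbT.
Qed.

(** The lower digits sum to less than [M ^ n], so division by [M ^ n] recovers the leading digit;
    induction handles the rest. *)
Lemma radix_inj (M n : nat) (a b : nat -> nat) :
  (forall i, (i < n)%N -> (a i < M)%N) -> (forall i, (i < n)%N -> (b i < M)%N) ->
  (\sum_(i < n) a i * M ^ i = \sum_(i < n) b i * M ^ i)%N ->
  forall i, (i < n)%N -> a i = b i.
Proof.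
elim: n => // n IHn aM bM; rewrite !big_ord_recr /= => eq_ab.
have aM' i : (i < n)%N -> (a i < M)%N by move=> /ltnW; exact: aM.
have bM' i : (i < n)%N -> (b i < M)%N by move=> /ltnW; exact: bM.
have eq_n : a n = b n.
  have Mn0 : (0 < M ^ n)%N by rewrite expn_gt0 (leq_ltn_trans _ (aM n _)).
  have := congr1 (fun m => m %/ M ^ n)%N eq_ab.
  by rewrite ![(\sum_(_ < n) _ + _)%N]addnC !divnMDl // !divn_small ?radix_lt // !addn0.
move=> i; rewrite ltnS leq_eqVlt => /predU1P[-> //|]; apply: IHn => //.
by move: eq_ab; rewrite eq_n => /addIn.
Qed.

(** No bound on [a v] is built in, so [digitsD] holds without carries; the bound by [M] enters only
    in [digits_lt] and [digits_inj]. *)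
Definition digits (V : finType) (M : nat) (a : V -> nat) : nat :=
  (\sum_(v : V) a v * M ^ enum_rank v)%N.

Lemma digitsE (V : finType) (M : nat) (a : V -> nat) (b : nat -> nat) :
  (forall i : 'I_#|V|, b i = a (enum_val i)) ->
  digits V M a = (\sum_(i < #|V|) b i * M ^ i)%N.
Proof.
move=> bE; rewrite /digits (reindex (enum_val : 'I_#|V| -> V)) /=; last exact/onW_bij/enum_val_bij.
by apply: eq_bigr => i _; rewrite enum_valK bE.
Qed.

Lemma digitsD (V : finType) (M : nat) (a b : V -> nat) :
  digits V M (fun v => a v + b v)%N = (digits V M a + digits V M b)%N.
Proof. by rewrite -big_split; apply: eq_bigr => v _; rewrite mulnDl. Qed.

Lemma digits_lt (V : finType) (M : nat) (a : V -> nat) :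
  (forall v, (a v < M)%N) -> (digits V M a < M ^ #|V|)%N.
Proof.
(* The digits are extended from ['I_#|V|] to [nat] to fit [radix_lt]; the default 0 is never read,
   since the sum stops at [#|V|]. *)
move=> aM; pose b i := if insub i is Some j then a (enum_val (j : 'I_#|V|)) else 0%N.
rewrite (digitsE _ _ _ b) => [|i]; last by rewrite /b valK.
by apply: radix_lt => i lt_i; rewrite /b insubT.
Qed.

Lemma digits_inj (V : finType) (M : nat) (a b : V -> nat) :
  (forall v, (a v < M)%N) -> (forall v, (b v < M)%N) ->
  digits V M a = digits V M b -> a =1 b.
Proof.
move=> aM bM.
pose ext (c : V -> nat) i :=
  if insub i is Some j then c (enum_val (j : 'I_#|V|)) else 0%N.
have extE c (i : 'I_#|V|) : ext c i = c (enum_val i) by rewrite /ext valK.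
have extM c : (forall v, (c v < M)%N) -> forall i, (i < #|V|)%N -> (ext c i < M)%N.
  by move=> cM i lt_i; rewrite /ext insubT.
rewrite (digitsE _ _ a (ext a)) // (digitsE _ _ b (ext b)) // => eq_ab v.
have := radix_inj _ _ _ _ (extM a aM) (extM b bM) eq_ab _ (ltn_ord (enum_rank v)).
by rewrite !extE enum_rankK.
Qed.

Lemma inZpD (n a b : nat) : inZp (a + b) = inZp a + inZp b :> 'I_n.+1.
Proof. by apply: val_inj; rewrite /= modnDm. Qed.

(* Digits at most L in base L.+1 leave room for adding one unit vector without
   carry, so the vertex u can translate by its place value. *)
Lemma coloring_base_grid (V : finType) (e : rel V) (L : nat)
    (D : {set {ffun V -> 'I_L}}) :
  (forall u v (i j : {ffun V -> 'I_L}), e u v -> i \in D -> j \in D ->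
    ~ (forall w, (i w + (w == u) = j w + (w == v))%N)) ->
  exists2 A : {set Zmod (L.+1 ^ #|V|)}, #|A| = #|D| & coloring_base e [set` A].
Proof.
set N := (L.+1 ^ #|V|)%N => disjD.
have N0 : (0 < N)%N by rewrite expn_gt0.
pose c (a : V -> nat) : Zmod N := inZp (digits V L.+1 a).
have cE a : (forall v, (a v < L.+1)%N) -> val (c a) = digits V L.+1 a.
  by move=> aL; rewrite /= modn_small // prednK // digits_lt.
have c_inj a b : (forall v, (a v < L.+1)%N) -> (forall v, (b v < L.+1)%N) ->
    c a = c b -> a =1 b.
  by move=> aL bL /(congr1 val); rewrite !cE //; exact: digits_inj.
have cD a b : c (fun v => a v + b v)%N = c a + c b by rewrite /c digitsD inZpD.
have iL (i : {ffun V -> 'I_L}) v : (i v < L.+1)%N by rewrite ltnW // ltnS.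
have iuL (i : {ffun V -> 'I_L}) u v : (i v + (v == u) < L.+1)%N.
  by rewrite -addn1 -addnA addnC; case: (v == u); have := ltn_ord (i v); lia.
exists [set c (fun v => val (i v)) | i : {ffun V -> 'I_L} in D]%SET.
  rewrite card_imset // => i j /c_inj eq_ij; apply/ffunP => v.
  by apply: val_inj; apply: eq_ij => w; exact: iL.
exists (fun u => c (fun v => (v == u) : nat)) => u v euv.
apply/seteqP; split=> // z [[_ /= /imsetP[i iD ->] <-] [_ /= /imsetP[j jD ->]]].
rewrite -!cD => /esym /c_inj eq_ij.
by apply: (disjD _ _ _ _ euv iD jD) => w; apply: eq_ij => ?; exact: iuL.
Qed.

(** * Pulling the circle back to the line, and from a circle base to a cyclic base *)

Local Notation circle_pi R := (\pi_(circle R)%qT).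

Lemma circle_piD (R : realType) (x y : R) : circle_pi R (x + y) = circle_pi R x + circle_pi R y.
Proof. exact: (Quotient.pi_add (GRing.ZmodClosed.clone R Num.int_num_subdef _)). Qed.

Lemma circle_pi_eq (R : realType) (x y : R) :
  circle_pi R x = circle_pi R y <-> exists n : int, x = y + n%:~R.
Proof.
have -> : (circle_pi R x = circle_pi R y) <-> (x - y \is a Num.int).
  by split=> [/eqP|?]; [|apply/eqP]; rewrite -Quotient.idealrBE.
split=> [/intrP[n xy]|[n ->]]; first by exists n; rewrite -xy addrC subrK.
by rewrite addrC addKr.
Qed.

Lemma circle_preimage_periodic (R : realType) (A : set (circle R)) :
  periodic (circle_pi R @^-1` A).
Proof.
move=> x n; suff e : circle_pi R (x + n%:~R) = circle_pi R x by rewrite /= e.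
by apply/circle_pi_eq; exists n.
Qed.

(** The sets with measurable preimage form a sigma-algebra, and it contains the open sets of the
    quotient topology. *)
Lemma circle_preimage_measurable (R : realType) (A : set (circle R)) :
  circle_borel A -> measurable (circle_pi R @^-1` A : set (measurableTypeR R)).
Proof.
pose G := [set A : set (circle R) |
  measurable (circle_pi R @^-1` A : set (measurableTypeR R))].
apply: (@smallest_sub _ (sigma_algebra setT) _ G); last first.
  by move=> U oU; exact: open_measurable.
split=> [|B mB|F mF]; rewrite /G /=.
- by rewrite preimage_set0.
- by rewrite setTD preimage_setC; exact: measurableC.
- by rewrite preimage_bigcup; exact: bigcupT_measurable.
Qed.

Lemma haar_le1 (R : realType) (A : set (circle R)) :
  circle_borel A -> (haar A <= 1)%E.
Proof.
move=> bA; rewrite -(lebesgue_measure_itvco01 R); apply: le_measure; last exact: subIsetr.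
  by rewrite inE; apply: measurableI; [exact: circle_preimage_measurable|exact: measurable_itv].
by rewrite inE; exact: measurable_itv.
Qed.

Lemma haar_fin_num (R : realType) (A : set (circle R)) :
  circle_borel A -> haar A \is a fin_num.
Proof.
by move=> bA; rewrite ge0_fin_numE // (le_lt_trans (haar_le1 _ _ bA)) // ltry.
Qed.

(* B is the set of grid points i with x + \sum_w i_w f w in A, for an x at which
   the number of such points is at least its average. *)
Lemma coloring_base_circle_grid (R : realType) (V : finType) (e : rel V)
    (A : set (circle R)) (L : nat) :
  circle_borel A -> coloring_base e A ->
  exists2 B : {set Zmod (L.+1 ^ #|V|)},
    L%:R ^+ #|V| * fine (haar A) <= #|B|%:R & coloring_base e [set` B].
Proof.
move=> bA [f fA].
(* Real representatives of the shifts let the averaging take place on the line. *)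
pose s (i : {ffun V -> 'I_L}) : R := \sum_w (i w)%:R * repr (f w).
have [x] := periodic_average R _ _ s (circle_preimage_measurable _ _ bA)
  (circle_preimage_periodic _ A).
set D := finset _ => leD.
have [u v i j euv iD jD ij|B cardB colB] := coloring_base_grid V e L D.
  have /seteqP[sub0 _] := fA u v euv.
  case: (sub0 (circle_pi R (x + s i) + f u)); split.
    by exists (circle_pi R (x + s i)) => //; move: iD; rewrite inE => /asboolP.
  exists (circle_pi R (x + s j)); first by move: jD; rewrite inE => /asboolP.
  rewrite -[f v]reprK -[f u]reprK -!circle_piD -!addrA; congr (circle_pi R (_ + _)).
  (* Adding [f z] raises the coefficient of [z] by one, so [i + delta_u = j + delta_v] would give
     the translates of [A] by [f u] and [f v] a common point. *)
  have sE (k : {ffun V -> 'I_L}) z :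
      s k + repr (f z) = \sum_w (k w + (w == z))%:R * repr (f w).
    rewrite /s -[repr (f z)]mul1r (bigD1 z) //= [RHS](bigD1 z) //= eqxx natrD mulrDl.
    rewrite addrAC; congr (_ + _); apply: eq_bigr => w /negPf ->.
    by rewrite addn0.
  by rewrite !sE; apply: eq_bigr => w _; rewrite ij.
exists B => //; rewrite cardB; apply: le_trans leD.
by rewrite card_ffun card_ord natrX.
Qed.

(** * From a cyclic base to a union of arcs on the circle *)

Lemma val_ZmodD (N : nat) (a b : Zmod N) :
  (0 < N)%N -> val (a + b) = ((val a + val b) %% N)%N.
Proof. by case: N a b. Qed.

Definition cell (R : realType) (N : nat) (a : Zmod N) : set R :=
  `](val a)%:R / N%:R, (val a).+1%:R / N%:R[%classic.

(* Open cells suffice for the measure, and make the blow-up open in the circle,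
   hence Borel. *)
Definition blowup (R : realType) (N : nat) (A : {set Zmod N}) : set (circle R) :=
  circle_pi R @` \bigcup_(a in [set` enum A]) cell R N a.

Lemma cellP (R : realType) (N : nat) (a : Zmod N) (x : R) : (0 < N)%N ->
  cell R N a x <-> (val a)%:R < x * N%:R < (val a).+1%:R.
Proof.
move=> N0; have N0' : 0 < N%:R :> R by rewrite ltr0n.
by rewrite /cell /= in_itv /= ltr_pdivrMr // ltr_pdivlMr.
Qed.

Lemma blowup_borel (R : realType) (N : nat) (A : {set Zmod N}) :
  circle_borel (blowup R N A).
Proof.
apply: sub_gen_smallest; rewrite /= /open /= /quotient_open.
(* A set is open in the quotient when its preimage is open; here the preimage consists of all
   integer translates of the open cells. *)
have -> : \pi_(quotient_topology (circle R))%qT @^-1` blowup R N A =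
    \bigcup_(n in [set: int]) \bigcup_(a in [set` enum A])
      `](val a)%:R / N%:R + n%:~R, (val a).+1%:R / N%:R + n%:~R[%classic.
  apply/seteqP; split=> x /=.
    move=> [y [a aA ay]] /esym /circle_pi_eq[n ->]; exists n => //; exists a => //.
    by move: ay; rewrite /cell /= !in_itv /= !ltrD2r.
  move=> [n _ [a aA ax]]; exists (x - n%:~R).
    by exists a => //; move: ax; rewrite /cell /= !in_itv /= ltrBrDr ltrBlDr.
  by apply/circle_pi_eq; exists (- n); rewrite rmorphN.
by apply: bigcup_open => n _; apply: bigcup_open => a _; exact: itv_open.
Qed.

Lemma cell_sub (R : realType) (N : nat) (a : Zmod N) : (0 < N)%N ->
  cell R N a `<=` `[0, 1[.
Proof.
move=> N0 x; have N0' : 0 < N%:R :> R by rewrite ltr0n.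
move/(cellP _ _ _ _ N0) => /andP[ax xa]; rewrite /= in_itv /=; apply/andP; split.
  by rewrite -(pmulr_rge0 _ N0') mulrC (le_trans _ (ltW ax)).
rewrite -(ltr_pM2r N0') mul1r (lt_le_trans xa) // ler_nat.
by rewrite -[leqRHS](prednK N0); exact: ltn_ord a.
Qed.

Lemma cell_inj (R : realType) (N : nat) (a b : Zmod N) (x : R) : (0 < N)%N ->
  cell R N a x -> cell R N b x -> a = b.
Proof.
move=> N0 /(cellP _ _ _ _ N0) /andP[ax xa] /(cellP _ _ _ _ N0) /andP[bx xb].
apply: val_inj; apply/eqP; rewrite eqn_leq.
apply/andP; split; rewrite -ltnS -(ltr_nat R); first exact: lt_trans ax xb.
exact: lt_trans bx xa.
Qed.

(** Inside [[0, 1[] the preimage of the blow-up contains [#|A|] disjoint cells of length [1 / N]. A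
    lower bound suffices for comparison with the supremum. *)
Lemma haar_blowup (R : realType) (N : nat) (A : {set Zmod N}) : (0 < N)%N ->
  #|A|%:R / N%:R <= fine (haar (blowup R N A)).
Proof.
move=> N0; have N0' : 0 < N%:R :> R by rewrite ltr0n.
rewrite -lee_fin fineK; last by apply: haar_fin_num; exact: blowup_borel.
have mC (a : Zmod N) : measurable (cell R N a : set (measurableTypeR R)).
  exact: measurable_itv.
have <- : lebesgue_measure
    (\bigcup_(a in [set` enum A]) cell R N a : set (measurableTypeR R)) =
    (#|A|%:R / N%:R)%:E :> \bar R.
  rewrite measure_fin_bigcup //; last first.
    by move=> a b _ _ [x [ax bx]]; exact: cell_inj ax bx.
  rewrite -fsbig_seq ?enum_uniq // big_enum.
  rewrite (eq_bigr (fun=> (N%:R^-1)%:E)) => [|a _].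
    by rewrite sumEFin sumr_const mulr_natl.
  rewrite [LHS]lebesgue_measure_itv /= lte_fin ltr_pM2r ?invr_gt0 // ltr_nat ltnSn.
  by rewrite -EFinB -mulrBl -natrB // subSnn mul1r.
apply: le_measure.
- by rewrite inE; exact: fin_bigcup_measurable.
- rewrite inE; apply: measurableI; last exact: measurable_itv.
  by apply: circle_preimage_measurable; exact: blowup_borel.
move=> x [a aA ax]; split; last exact: cell_sub ax.
by exists x => //; exists a.
Qed.

(** Vertex [v] shifts by [f v / N]. If shifted cells [a] and [b] meet up to an integer [m], then
    after scaling by [N] the integer [(a + f u) - (b + f v) - m N] lies strictly between -1 and 1,
    hence vanishes, and [a + f u = b + f v] in [Zmod N]. *)
Lemma coloring_base_blowup (R : realType) (V : finType) (e : rel V) (N : nat)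
    (A : {set Zmod N}) : (0 < N)%N ->
  coloring_base e [set` A] -> coloring_base e (blowup R N A).
Proof.
move=> N0 [f fA]; have N0' : N%:R != 0 :> R by rewrite pnatr_eq0 -lt0n.
exists (fun v => circle_pi R ((val (f v))%:R / N%:R)) => u v euv.
apply/seteqP; split=> // z [[_ [x [a aA ax] <-] <-] [_ [y [b bA bY] <-]]].
rewrite -!circle_piD => /esym/circle_pi_eq[m xy].
have /seteqP[sub0 _] := fA u v euv.
case: (sub0 (a + f u)); split; first by exists a => //; rewrite /= -mem_enum.
exists b; first by rewrite /= -mem_enum.
have {}xy : x * N%:R + (val (f u))%:R = y * N%:R + (val (f v))%:R + m%:~R * N%:R.
  by move/(congr1 (fun t => t * N%:R)): xy; rewrite !mulrDl !divfK.
move: ax bY => /(cellP _ _ _ _ N0) /andP[ax xa] /(cellP _ _ _ _ N0) /andP[bx xb].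
have lt1 : ((val a + val (f u))%:Z - (val b + val (f v))%:Z - m * N%:Z < 1)%R.
  rewrite -(ltr_int R) !(rmorphB, rmorphD, rmorphM, rmorph1) /= -!natrD.
  rewrite -!pmulrn !natrD; move: ax xa bx xb; rewrite -!natr1; lra.
have gt1 : (-1 < (val a + val (f u))%:Z - (val b + val (f v))%:Z - m * N%:Z)%R.
  rewrite -(ltr_int R) !(rmorphB, rmorphD, rmorphM, rmorphN, rmorph1) /= -!natrD.
  rewrite -!pmulrn !natrD; move: ax xa bx xb; rewrite -!natr1; lra.
apply: val_inj; rewrite !val_ZmodD //.
have e0 : ((val b + val (f v))%:Z = (val a + val (f u))%:Z - m * N%:Z)%R by lia.
have := congr1 (fun t => (t %% N%:Z)%Z) e0.
by rewrite -mulNr addrC modzMDl !modz_nat => -[].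
Qed.

(** * Letting the grid size tend to infinity, and the final comparison *)

Lemma bernoulli_ge (R : realFieldType) (x : R) (n : nat) :
  0 <= x <= 1 -> 1 - n%:R * x <= (1 - x) ^+ n.
Proof.
move=> /andP[x0 x1]; elim: n => [|n IHn]; first by rewrite mul0r subr0.
rewrite exprS; apply: (@le_trans _ _ ((1 - x) * (1 - n%:R * x))).
  have nxx : 0 <= n%:R * x * x by rewrite !mulr_ge0.
  by rewrite -natr1; lra.
by rewrite ler_wpM2l // subr_ge0.
Qed.

Lemma limit_ratio_le1 (R : realType) (n : nat) (c : R) :
  (forall L : nat, c * L%:R ^+ n <= L.+1%:R ^+ n) -> c <= 1.
Proof.
move=> cL; rewrite leNgt; apply/negP => c1.
(* This choice gives [(c - 1) (L + 1) > c n], that is [c (1 - n / (L + 1)) > 1], which contradicts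
   [cL] through Bernoulli's inequality with [x = 1 / (L + 1)]. *)
pose L := Num.bound (c * n%:R / (c - 1)); have c10 : 0 < c - 1 by rewrite subr_gt0.
have bL : c * n%:R < L%:R * (c - 1).
  rewrite -ltr_pdivrMr //; apply: archi_boundP.
  by apply: divr_ge0; [apply: mulr_ge0 => //; lra|exact: ltW].
have L1 : 0 < L.+1%:R :> R by rewrite ltr0n.
have x01 : 0 <= (L.+1%:R^-1 : R) <= 1 by rewrite invr_ge0 ler0n invf_le1 // ler1n.
have := bernoulli_ge _ _ n x01.
have -> : 1 - L.+1%:R^-1 = L%:R / L.+1%:R :> R.
  by rewrite -natr1; field; rewrite natr1; exact: lt0r_neq0.
rewrite expr_div_n ler_pdivlMr ?exprn_gt0 // => bern.
have := le_trans (ler_wpM2l (ltW (lt_trans ltr01 c1)) bern) (cL L).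
rewrite mulrA -[leRHS]mul1r ler_pM2r ?exprn_gt0 // mulrBr mulr1 mulrA.
rewrite lerBlDr -lerBlDl ler_pdivlMr // -natr1; nra.
Qed.

Theorem corollary3 (R : realType) (V : finType) (e : rel V)
    (e_sym : symmetric e) (e_irr : irreflexive e) :
  gyrochromatic R e =
  inf [set r : R | exists N K : nat, [/\ (0 < N)%N, (0 < K)%N,
    r = N%:R / K%:R &
    exists2 A : {set Zmod N}, #|A| = K & coloring_base e [set` A]]].
Proof.
set T := [set r : R | _]; rewrite /gyrochromatic /sigma_circle.
set S := [set fine (haar A) | A in _]; set m := inf T.
have leS N (A : {set Zmod N}) : (0 < N)%N -> coloring_base e [set` A] ->
    #|A|%:R / N%:R <= sup S.
  move=> N0 colA; apply: le_trans (haar_blowup _ _ _ N0) _.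
  apply: ub_le_sup; last first.
    by exists (blowup R N A) => //; split; [exact: blowup_borel|exact: coloring_base_blowup].
  exists 1 => _ [B [bB _] <-].
  by rewrite -lee_fin fineK; [exact: haar_le1|exact: haar_fin_num].
(* A single point with pairwise distinct shifts is a base. It makes [sup S] positive and [T]
   nonempty, so neither the quotient nor the infimum takes a default value; the modulus [#|V|.+1] is
   positive even for an empty graph. *)
have [A0 cardA0 colA0] : exists2 A : {set Zmod #|V|.+1},
    #|A| = 1%N & coloring_base e [set` A].
  exists [set 0]%SET; first exact: cards1.
  exists (fun v => inord (enum_rank v)) => u v euv.
  apply/seteqP; split=> // _ [[a /= + <-] [b /= +]]; rewrite !inE => /eqP -> /eqP ->.
  rewrite !add0r => /(congr1 val); rewrite /= !inordK; try exact/ltnW/ltn_ord.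
  by move=> /val_inj/enum_rank_inj uv; move: euv; rewrite uv e_irr.
have supS0 : 0 < sup S.
  by apply: lt_le_trans (leS _ _ (ltn0Sn _) colA0); rewrite cardA0 divr_gt0.
have T0 : T !=set0.
  by exists (#|V|.+1%:R / 1%:R), #|V|.+1, 1%N; split=> //; exists A0.
have lbT : lbound T (1 / sup S).
  move=> _ [N [K [N0 K0 -> [A cardA colA]]]].
  have := leS _ A N0 colA; rewrite cardA.
  by rewrite ler_pdivrMr ?ltr0n // ler_pdivlMr ?ltr0n // mulrAC ler_pdivrMr // mul1r mulrC.
have le_m : 1 / sup S <= m by exact: lb_le_inf.
have m0 : 0 < m by apply: lt_le_trans le_m; rewrite divr_gt0.
(* The remaining inequality is recast as [sup S <= 1 / m], so that it can be checked on one Borel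
   base [A] at a time. *)
apply/eqP; rewrite eq_le le_m /= ler_pdivlMr // mulrC -ler_pdivlMr //.
apply: ge_sup => [|_ [A [bA colA] <-]].
  by exists (fine (haar (blowup R _ A0))), (blowup R _ A0); split;
    [exact: blowup_borel|exact: coloring_base_blowup].
(* With [c = mu(A) m] the goal for each [L] is [c L^n <= (L + 1)^n]; it follows from
   [mu(A) L^n <= #|B|] and [m <= (L + 1)^n / #|B|]. *)
rewrite ler_pdivlMr //; apply: (limit_ratio_le1 _ #|V|) => L.
have [B leB colB] := coloring_base_circle_grid _ _ _ _ L bA colA.
apply: (@le_trans _ _ (#|B|%:R * m)); first by rewrite mulrAC ler_wpM2r ?(ltW m0) // mulrC.
(* An empty [B] yields no element of [T], but then the bound is trivial. *)
have [->|B0] := posnP #|B|; first by rewrite mul0r exprn_ge0.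
rewrite mulrC -ler_pdivlMr ?ltr0n //; apply: ge_inf; first by exists (1 / sup S).
exists (L.+1 ^ #|V|)%N, #|B|; split=> //; first by rewrite expn_gt0.
  by rewrite natrX.
by exists B.
Qed.
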